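(* Let $k\ge 2$, $n,m,r\ge 1$, and consider a $k$-valued control network $X_i(t+1)=f_i(X_1(t),\dots,X_n(t),U_1(t),\dots,U_m(t))$, $i\in[1,n]$, with algebraic form $x(t+1)=Lu(t)x(t)$, $L=[M_1,M_2,\dots,M_{k^m}]\in\mathcal{L}_{k^n\times k^{n+m}}$, $M_i\in\mathcal{L}_{k^n\times k^n}$. Let $\mathcal{Z}=\mathcal{F}_\ell(Z_1,\dots,Z_r)$ be the dual subspace generated by $k$-valued logical functions $Z_1,\dots,Z_r$ of $X_1,\dots,X_n$, with structure matrix $G\in\mathcal{L}_{k^r\times k^n}$. Then $\mathcal{Z}$ is a dual control-invariant subspace of the control network if and only if one of the following two equivalent conditions is satisfied: (i) There exists $H\in\mathcal{L}_{k^r\times k^r}$ such that for all $j\in[1,k^n]$, $$J_j:=\{\,i\in[1,k^m] \mid \mathrm{Col}_j(GM_i)=\mathrm{Col}_j(HG)\,\}\neq\emptyset .$$ (ii) There exists a state feedback control $u(t)=Fx(t)$, with $F\in\mathcal{L}_{k^m\times k^n}$, such that $\mathcal{Z}$ is $M$-invariant, where $M:=LF\,\mathrm{PR}_{k^n}$ (that is, $M=L(F\otimes I_{k^n})\mathrm{PR}_{k^n}$, the matrix with $Mx=L(Fx\otimes x)$ for all $x\in\Delta_{k^n}$).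
   Context: Notation. $[1,n]=\{1,\dots,n\}$; $\mathcal{D}_k=\{1,\dots,k\}$; $\delta_n^i$ is the $i$-th column of the identity matrix $I_n$; $\Delta_n=\{\delta_n^1,\dots,\delta_n^n\}$; $\mathrm{Col}_j(A)$ is the $j$-th column of $A$; $\mathcal{L}_{p\times q}$ is the set of $p\times q$ logical matrices, i.e. matrices all of whose columns lie in $\Delta_p$; $\mathrm{PR}_N=\mathrm{diag}(\delta_N^1,\dots,\delta_N^N)\in\mathcal{L}_{N^2\times N}$ (block diagonal), so $\mathrm{PR}_N x=x\otimes x$ for $x\in\Delta_N$. Control network. $X_i,U_j\in\mathcal{D}_k$ and $f_i:\mathcal{D}_k^{n+m}\to\mathcal{D}_k$ are arbitrary functions. A value $j\in\mathcal{D}_k$ is identified with $\delta_k^j$. Write $x_i\in\Delta_k$ for the vector form of $X_i$, $x=x_1\otimes\cdots\otimes x_n\in\Delta_{k^n}$, and similarly $u=u_1\otimes\cdots\otimes u_m\in\Delta_{k^m}$. $L\in\mathcal{L}_{k^n\times k^{n+m}}$ is the unique logical matrix such that $x(t+1)=L(u(t)\otimes x(t))$ (written $Lu(t)x(t)$), and $L$ is split into $k^m$ equal blocks $M_i\in\mathcal{L}_{k^n\times k^n}$, so that $M_i x=L(\delta_{k^m}^i\otimes x)$. Dual subspaces. For $k$-valued logical functions $Z_i=g_i(X_1,\dots,X_n)$, $i\in[1,r]$, $\mathcal{Z}=\mathcal{F}_\ell(Z_1,\dots,Z_r)$ is the set of all $k$-valued logical functions of $Z_1,\dots,Z_r$.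 Its structure matrix is the unique $G\in\mathcal{L}_{k^r\times k^n}$ with $z:=z_1\otimes\cdots\otimes z_r=Gx$, $z_i\in\Delta_k$ being the vector form of $Z_i$. $M$-invariance. For $M\in\mathcal{L}_{k^n\times k^n}$, $\mathcal{Z}$ is $M$-invariant (an invariant dual subspace of $x(t+1)=Mx(t)$) if there is $H\in\mathcal{L}_{k^r\times k^r}$ with $GM=HG$; equivalently, along all trajectories $z(t)=Gx(t)$ obeys $z(t+1)=Hz(t)$. Dual control-invariance. $\mathcal{Z}$ is a dual control-invariant subspace of the control network if there is $H\in\mathcal{L}_{k^r\times k^r}$ such that for every initial state $x(0)\in\Delta_{k^n}$ there is a control sequence $\{u(t)\mid t\ge 0\}$ for which the controlled trajectory satisfies $z(t+1)=Hz(t)$ for all $t\ge0$, where $z(t)=Gx(t)$. *)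

(* Defs.v *)
From mathcomp Require Export all_boot all_order all_algebra.
From mathcomp Require Export mxtens.

Set Implicit Arguments.
Unset Strict Implicit.
Unset Printing Implicit Defensive.

Import GRing.Theory.
Local Open Scope ring_scope.

(* All index sets are 0-based: [1,n], D_k and the indices of delta_n^i are     *)
(* rendered by 'I_n, 'I_k and 'I_n. Logical matrices have entries in int.      *)

Definition delta (p : nat) (i : 'I_p) : 'cV[int]_p := col i 1%:M.

Definition logical_mx (p q : nat) (A : 'M[int]_(p, q)) : Prop :=
  forall j, exists i, col j A = delta i.

(* The dimension of a Kronecker product of columns is (p * q) x (1 * 1), and   *)
(* 1 * 1 is convertible to 1.                                                  *)
Definition tensv (p q : nat) (u : 'cV[int]_p) (v : 'cV[int]_q) :
  'cV[int]_(p * q) := u *t v.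

(* v_0 *t (v_1 *t (... *t v_(n-1))), with the first factor most significant.   *)
Fixpoint bigtensv (k n : nat) : ('I_n -> 'cV[int]_k) -> 'cV[int]_(k ^ n) :=
  match n with
  | 0 => fun=> const_mx 1
  | n'.+1 => fun v =>
      castmx (esym (expnS k n'), erefl)
             (tensv (v ord0) (bigtensv (fun i => v (lift ord0 i))))
  end.

Definition vec (k n : nat) (X : {ffun 'I_n -> 'I_k}) : 'cV[int]_(k ^ n) :=
  bigtensv (fun i => delta (X i)).

(* PR_N : the N x 1 block at block position (a, j) is delta_N^j if a = j and   *)
(* 0 otherwise.                                                                *)
Definition PR (N : nat) : 'M[int]_(N * N, N) :=
  \matrix_(i, j) (if (mxtens_unindex i).1 == j
                  then delta j (mxtens_unindex i).2 0 else 0).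

Definition network (k n m : nat) : Type :=
  'I_n -> {ffun 'I_n -> 'I_k} -> {ffun 'I_m -> 'I_k} -> 'I_k.

Definition network_step (k n m : nat) (f : network k n m)
    (X : {ffun 'I_n -> 'I_k}) (U : {ffun 'I_m -> 'I_k}) : {ffun 'I_n -> 'I_k} :=
  [ffun i => f i X U].

Fixpoint trajectory (k n m : nat) (f : network k n m)
    (X0 : {ffun 'I_n -> 'I_k}) (U : nat -> {ffun 'I_m -> 'I_k}) (t : nat) :
    {ffun 'I_n -> 'I_k} :=
  if t is t'.+1 then network_step f (trajectory f X0 U t') (U t') else X0.

(* The k^(n+m) columns of L are indexed by 'I_(k ^ m * k ^ n), the index set   *)
(* of u *t x, so no cast along k ^ (n + m) = k ^ m * k ^ n is needed.          *)
Definition algebraic_form (k n m : nat) (f : network k n m)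
    (L : 'M[int]_(k ^ n, k ^ m * k ^ n)) : Prop :=
  logical_mx L /\
  forall X U, vec (network_step f X U) = L *m tensv (vec U) (vec X).

(* The block M_i of L = [M_1, ..., M_p], each block having q columns.          *)
Definition block (s p q : nat) (L : 'M[int]_(s, p * q)) (i : 'I_p) :
    'M[int]_(s, q) :=
  colsub (fun j => mxtens_index (i, j)) L.

Definition structure_matrix (k n r : nat)
    (g : 'I_r -> {ffun 'I_n -> 'I_k} -> 'I_k) (G : 'M[int]_(k ^ r, k ^ n)) :
    Prop :=
  logical_mx G /\ forall X, vec [ffun i => g i X] = G *m vec X.

(* The two invariance notions below are properties of the dual subspace        *)
(* F_l(Z_1, ..., Z_r), expressed through its structure matrix G.               *)

Definition mx_invariant (q p : nat) (G : 'M[int]_(q, p)) (M : 'M[int]_p) :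
    Prop :=
  exists2 H : 'M[int]_q, logical_mx H & G *m M = H *m G.

(* The initial states x(0) in Delta_(k^n) are the vectors vec X0.              *)
Definition dual_control_invariant (k n m r : nat) (f : network k n m)
    (G : 'M[int]_(k ^ r, k ^ n)) : Prop :=
  exists2 H : 'M[int]_(k ^ r), logical_mx H &
    forall X0 : {ffun 'I_n -> 'I_k},
    exists U : nat -> {ffun 'I_m -> 'I_k},
      let z t := G *m vec (trajectory f X0 U t) in
      forall t, z t.+1 = H *m z t.

(* Main.v *)
Require Import Defs.

(** Logical vectors are exactly the vector forms of tuples, so both invariance
    notions reduce to equations between columns.  The first step of the controlled
    trajectories gives (i), with [i] in [J_j] read off the first control; a choice
    of an element of each [J_j] is a feedback [F]; and the controls produced along
    the closed loop of [F] realise [z(t+1) = H z(t)]. *)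

Set Implicit Arguments.
Unset Strict Implicit.
Unset Printing Implicit Defensive.

Import GRing.Theory.
Local Open Scope ring_scope.

Lemma deltaE (p : nat) (i : 'I_p) (a : 'I_p) (b : 'I_1) :
  delta i a b = (a == i)%:R.
Proof. by rewrite !mxE. Qed.

Lemma mulmx_delta (p q : nat) (A : 'M[int]_(p, q)) (j : 'I_q) :
  A *m delta j = col j A.
Proof. by rewrite /delta !colE mul1mx. Qed.

Lemma col_mulmx (p q s : nat) (A : 'M[int]_(p, q)) (B : 'M[int]_(q, s)) (j : 'I_s) :
  col j (A *m B) = A *m col j B.
Proof. by rewrite !colE mulmxA. Qed.

Lemma matrix_col_eq (p q : nat) (A B : 'M[int]_(p, q)) :
  (forall j, col j A = col j B) -> A = B.
Proof. by move=> AB; apply/matrixP=> i j; move/colP/(_ i): (AB j); rewrite !mxE. Qed.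

Lemma tensv_delta (p q : nat) (i : 'I_p) (j : 'I_q) :
  tensv (delta i) (delta j) = delta (mxtens_index (i, j)).
Proof.
apply/matrixP=> a b; case: (mxtens_indexP a) => a1 a2.
rewrite deltaE (can_eq (@mxtens_indexK p q)) xpair_eqE /tensv [LHS]mxE.
by rewrite mxtens_indexK !deltaE /= -natrM mulnb.
Qed.

Lemma castmx_delta (p q : nat) (e : p = q) (i : 'I_p) :
  castmx (e, erefl) (delta i) = delta (cast_ord e i).
Proof. by case: q / e; rewrite castmx_id cast_ord_id. Qed.

Lemma vec_delta (k n : nat) (X : {ffun 'I_n -> 'I_k}) :
  exists i, vec X = delta i.
Proof.
(* The induction runs over plain functions, because [bigtensv] recurses on a shifted function that
   is not a finfun. *)
rewrite /vec; move: (fun_of_fin X : 'I_n -> 'I_k) => x {X}.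
elim: n x => [|n IHn] x /=.
  by exists ord0; apply/matrixP=> a b; rewrite deltaE mxE (ord1 a).
have [i ->] := IHn (fun i => x (lift ord0 i)).
by rewrite tensv_delta castmx_delta; eexists.
Qed.

Lemma eq_bigtensv (k n : nat) (v w : 'I_n -> 'cV[int]_k) :
  v =1 w -> bigtensv v = bigtensv w.
Proof.
elim: n v w => [//|n IHn] v w vw /=.
by rewrite vw (IHn _ (fun i => w (lift ord0 i))).
Qed.

(** Base-[k] expansion of [j]: the leading digit is the first tensor factor, and induction treats
    the remainder. Hence a condition on every column is a condition on every initial state. *)
Lemma delta_vec (k n : nat) (j : 'I_(k ^ n)) :
  exists X : {ffun 'I_n -> 'I_k}, vec X = delta j.
Proof.
suff [x xj] : exists x : 'I_n -> 'I_k, bigtensv (fun i => delta (x i)) = delta j.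
  by exists (finfun x); rewrite -xj; apply: eq_bigtensv => i; rewrite ffunE.
elim: n j => [|n IHn] j /=.
  (* The empty tuple: [k ^ 0] is 1, so [j] is the only index. *)
  exists (fun i : 'I_0 => match notF (valP i) with end).
  by apply/matrixP=> a b; rewrite deltaE mxE (ord1 a) (ord1 j).
rewrite -(cast_ordK (expnS k n) j).
case: (mxtens_indexP (cast_ord (expnS k n) j)) => a b.
have [x xb] := IHn b.
exists (fun i => if unlift ord0 i is Some i' then x i' else a).
rewrite unlift_none (eq_bigtensv (w := fun i => delta (x i))) => [|i].
  by rewrite xb tensv_delta castmx_delta.
by rewrite liftK.
Qed.

Lemma col_block (s p q : nat) (L : 'M[int]_(s, p * q)) (i : 'I_p) (j : 'I_q) :
  col j (block L i) = L *m tensv (delta i) (delta j).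
Proof. by rewrite tensv_delta mulmx_delta; apply/colP=> a; rewrite !mxE. Qed.

Lemma PR_delta (N : nat) (j : 'I_N) :
  PR N *m delta j = tensv (delta j) (delta j).
Proof.
rewrite tensv_delta mulmx_delta; apply/matrixP=> a b.
case: (mxtens_indexP a) => a1 a2; rewrite [LHS]mxE [LHS]mxE mxtens_indexK /=.
rewrite !deltaE (can_eq (@mxtens_indexK N N)) xpair_eqE.
by case: (a1 == j).
Qed.

(** [PR q] duplicates a basis vector, and the mixed-product rule lets [F] act on the first copy
    alone. *)
Lemma feedback_delta (s p q : nat) (L : 'M[int]_(s, p * q)) (F : 'M[int]_(p, q))
    (j : 'I_q) :
  L *m (F *t 1%:M) *m PR q *m delta j = L *m tensv (F *m delta j) (delta j).
Proof.
rewrite -!mulmxA PR_delta; congr (L *m _).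
by rewrite /tensv (tensmx_mul F 1%:M (delta j) (delta j)) mul1mx.
Qed.

Lemma logical_mx_cols (p q : nat) (c : 'I_q -> 'I_p) :
  exists2 F : 'M[int]_(p, q), logical_mx F & forall j, F *m delta j = delta (c j).
Proof.
pose F : 'M[int]_(p, q) := \matrix_(a, j) (a == c j)%:R.
have Fc j : col j F = delta (c j) by apply/matrixP=> a b; rewrite deltaE !mxE.
by exists F => j; [exists (c j) | rewrite mulmx_delta].
Qed.

(** Turns a feedback law into an open-loop control sequence: the closed loop is iterated first, its
    controls are recorded, and induction on time shows that they reproduce the same states. *)
Lemma trajectory_feedback (k n m : nat) (f : network k n m)
    (phi : {ffun 'I_n -> 'I_k} -> {ffun 'I_m -> 'I_k}) (X0 : {ffun 'I_n -> 'I_k}) :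
  exists U, forall t, U t = phi (trajectory f X0 U t).
Proof.
pose x t := iter t (fun X => network_step f X (phi X)) X0.
exists (fun t => phi (x t)) => t; congr (phi _).
by elim: t => //= t <-.
Qed.

Theorem theorem4 (k n m r : nat)
    (hk : (2 <= k)%N) (hn : (1 <= n)%N) (hm : (1 <= m)%N) (hr : (1 <= r)%N)
    (f : network k n m) (L : 'M[int]_(k ^ n, k ^ m * k ^ n))
    (hL : algebraic_form f L)
    (g : 'I_r -> {ffun 'I_n -> 'I_k} -> 'I_k) (G : 'M[int]_(k ^ r, k ^ n))
    (hG : structure_matrix g G) :
  [<-> dual_control_invariant f G;
       exists2 H : 'M[int]_(k ^ r), logical_mx H &
         forall j : 'I_(k ^ n),
           [set i : 'I_(k ^ m) | col j (G *m block L i) == col j (H *m G)]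
             != set0;
       exists2 F : 'M[int]_(k ^ m, k ^ n), logical_mx F &
         mx_invariant G (L *m (F *t 1%:M) *m PR (k ^ n))].
Proof.
have [_ stepE] := hL.
tfae.
- case=> H Hlog Hinv; exists H => // j.
  (* Time 0 suffices, since the state encoded by [j] may be taken as initial state. *)
  have [X Xj] := delta_vec j; have [U /(_ 0%N)/= zU] := Hinv X.
  have [i Ui] := vec_delta (U 0%N).
  apply/set0Pn; exists i; rewrite inE; apply/eqP.
  by rewrite col_mulmx col_block -Ui -Xj -stepE zU Xj mulmxA mulmx_delta.
- case=> H Hlog HJ.
  (* Choice over the finitely many columns; [c j] becomes column [j] of [F], and [H] is kept. *)
  have /fin_all_exists[c cP] j : exists i, col j (G *m block L i) = col j (H *m G).
    by have /set0Pn[i] := HJ j; rewrite inE => /eqP; exists i.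
  have [F Flog Fc] := logical_mx_cols c.
  exists F => //; exists H => //; apply: matrix_col_eq => j.
  by rewrite -cP [LHS]col_mulmx [RHS]col_mulmx col_block -Fc -feedback_delta mulmx_delta.
- case=> F Flog [H Hlog GM]; exists H => // X0.
  (* [phi] is [F] read on tuples: columns of [F] are logical, so each encodes a control. *)
  have /fin_all_exists[phi phiP] X : exists U : {ffun 'I_m -> 'I_k},
      vec U = F *m vec X.
    have [j ->] := vec_delta X; rewrite mulmx_delta.
    by have [i ->] := Flog j; apply: delta_vec.
  have [U UE] := trajectory_feedback f phi X0.
  exists U => z t; rewrite /z /= stepE {1}UE phiP.
  have [j ->] := vec_delta (trajectory f X0 U t).
  by rewrite -feedback_delta !mulmxA -GM !mulmxA.
Qed.
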